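(* Let $\lambda\ge 2$, and let $\mathcal{D}$ be the design obtained from a projective plane with line size $k$ and $v=k^2-k+1$ points by repeating each line $\lambda$ times. Let $\Gamma$ be the graph whose vertices are the $v$ points and the $\lambda v$ blocks of $\mathcal{D}$, where any two distinct points are adjacent, a point and a block are adjacent if and only if they are incident, and two distinct blocks are adjacent if and only if they are copies of the same line (so the blocks induce a disjoint union of cliques of size $\lambda$). Then $\Gamma$ has exactly three distinct $\mathcal{L}$-eigenvalues, the non-trivial (non-zero) ones being $\frac{v}{k^2+k(\lambda-1)}$ and $1+\frac{1}{k+\lambda-1}$.
   Context: All graphs are finite, simple and undirected. $d_u$ denotes the valency (degree) of vertex $u$. The normalized Laplacian of a graph is the matrix $\mathcal{L}=[\ell_{uv}]$ indexed by the vertices with $\ell_{uu}=1$ if $d_u\neq 0$, $\ell_{uv}=-1/\sqrt{d_ud_v}$ if $u$ and $v$ are adjacent, and $\ell_{uv}=0$ otherwise. Its eigenvalues are called the $\mathcal{L}$-eigenvalues of the graph. A projective plane with line size $k$ means here a symmetric $2$-$(k^2-k+1,k,1)$ design with $k\ge2$: there are $v=k^2-k+1$ points and $v$ lines, every line has $k$ points, every point is on $k$ lines, and any two distinct points are on exactly one common line. *)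

(* Defs.v *)
From HB Require Import structures.
From mathcomp Require Import all_boot all_order all_algebra.

Set Implicit Arguments.
Unset Strict Implicit.
Unset Printing Implicit Defensive.

Import Order.TTheory GRing.Theory Num.Theory.
Local Open Scope ring_scope.

Record sgraph := SGraph {
  vertex :> finType;
  adj : rel vertex;
  adj_sym : symmetric adj;
  adj_irrefl : irreflexive adj
}.

Definition valency (G : sgraph) (u : G) : nat := #|[set w : G | adj u w]|.

Definition nlaplacian_entry (R : rcfType) (G : sgraph) (u w : G) : R :=
  if u == w then (if valency u != 0%N then 1 else 0)
  else if adj u w then - (Num.sqrt ((valency u)%:R * (valency w)%:R))^-1
  else 0.

(* Rows and columns are indexed by the vertices through [enum_val]. *)
Definition nlaplacian (R : rcfType) (G : sgraph) : 'M[R]_#|G| :=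
  \matrix_(i < #|G|, j < #|G|) nlaplacian_entry R (enum_val i) (enum_val j).

(* The matrix is real symmetric, so all its eigenvalues already lie in [R]. *)
Definition Leigenvalue (R : rcfType) (G : sgraph) : pred R :=
  eigenvalue (nlaplacian R G).

Record projective_plane (k : nat) (P L : finType) (inc : P -> L -> bool) : Prop :=
  ProjectivePlane {
    plane_line_size_ge2 : (2 <= k)%N;
    plane_card_points : #|P| = (k ^ 2 - k + 1)%N;
    plane_card_lines : #|L| = (k ^ 2 - k + 1)%N;
    plane_points_on_line : forall l : L, #|[set p : P | inc p l]| = k;
    plane_lines_on_point : forall p : P, #|[set l : L | inc p l]| = k;
    plane_unique_line : forall p q : P, p != q ->
      exists! l : L, inc p l /\ inc q l
  }.

Section RepeatedDesignGraph.

Variables (P L : finType) (inc : P -> L -> bool) (lam : nat).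

(* The block (l, i) is the i-th copy of the line l. *)
Definition block : finType := (L * 'I_lam)%type.

Definition block_inc (p : P) (b : block) : bool := inc p b.1.

Definition design_adj (x y : P + block) : bool :=
  match x, y with
  | inl p, inl q => p != q
  | inl p, inr b => block_inc p b
  | inr b, inl p => block_inc p b
  | inr b, inr c => (b != c) && (b.1 == c.1)
  end.

Lemma design_adj_sym : symmetric design_adj.
Proof.
by move=> [p|b] [q|c] //=; rewrite eq_sym // [c.1 == _]eq_sym.
Qed.

Lemma design_adj_irrefl : irreflexive design_adj.
Proof. by move=> [p|b] /=; rewrite eqxx. Qed.

Definition design_graph : sgraph := SGraph design_adj_sym design_adj_irrefl.

End RepeatedDesignGraph.

(* Main.v *)
Require Import Defs.
From HB Require Import structures.
From mathcomp Require Import all_boot all_order all_algebra.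
From mathcomp Require Import ring lra zify.

Set Implicit Arguments.
Unset Strict Implicit.
Unset Printing Implicit Defensive.

Import Order.TTheory GRing.Theory Num.Theory.
Local Open Scope ring_scope.

(** In random walk form the eigenvalue equations read, with m = k + lam - 1,
    t = m * (1 - x) and S the sum of g over the points,
      (k t + 1) g p = S + \sum_(b on p) g b   and
      (t + 1) g (l, i) = \sum_(p on l) g p + \sum_j g (l, j).
    Unless t = -1, g is constant on the copies of each line; eliminating the
    blocks with N N^T = (k - 1) I + J, N the incidence matrix, then leaves
    (k t + 1 - k lam) g p = S for every point p.  Summing over p gives t = m or
    S = 0, and S = 0 forces k t + 1 = k lam unless g vanishes on the points; in
    that last case g = 0, because N is invertible.  The three values of t are
    x = theta2, 0 and theta1. *)

(** * From the normalized Laplacian to adjacency sums *)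

Lemma sum_nlaplacian_entry (R : rcfType) (G : sgraph)
    (hG : forall u : G, valency u != 0%N) (g : G -> R) (w : G) :
  \sum_u (g u * Num.sqrt (valency u)%:R) * nlaplacian_entry R u w =
  g w * Num.sqrt (valency w)%:R
    - (\sum_(u | adj w u) g u) / Num.sqrt (valency w)%:R.
Proof.
have s0 (u : G) : Num.sqrt (valency u)%:R != 0 :> R.
  by rewrite gt_eqF // sqrtr_gt0 ltr0n lt0n.
rewrite (bigD1 w) //= /nlaplacian_entry eqxx hG mulr1; congr (_ + _).
rewrite mulr_suml -sumrN [RHS]big_mkcond [LHS]big_mkcond /=.
apply: eq_bigr => u _; rewrite (adj_sym w u); case: eqVneq => [->|_] /=.
  by rewrite adj_irrefl.
case: ifP => _; last by rewrite mulr0.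
(* The weight at [u] cancels one of the two roots in the entry, so only the root at [w] is left. *)
by rewrite sqrtrM ?ler0n //; field; rewrite !s0.
Qed.

(* The substitution [f u = g u * sqrt (d u)] turns the normalized Laplacian
   into the random walk operator, which involves no square roots. *)
Lemma LeigenvalueP (R : rcfType) (G : sgraph)
    (hG : forall u : G, valency u != 0%N) (x : R) :
  Leigenvalue G x <->
  exists2 g : G -> R, (exists u, g u != 0) &
    forall u, (valency u)%:R * (1 - x) * g u = \sum_(w | adj u w) g w.
Proof.
have s0 (u : G) : Num.sqrt (valency u)%:R != 0 :> R.
  by rewrite gt_eqF // sqrtr_gt0 ltr0n lt0n.
have sE (u : G) : (valency u)%:R = Num.sqrt (valency u)%:R * Num.sqrt (valency u)%:R :> R.
  by rewrite -expr2 sqr_sqrtr // ler0n.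
(* Any matching pair is allowed, so that one direction can start from [f] and divide by the roots,
   the other from [g] and multiply. *)
have key (f : 'rV[R]_#|G|) (g : G -> R) :
    (forall i, f 0 i = g (enum_val i) * Num.sqrt (valency (enum_val i))%:R) ->
    f *m nlaplacian R G = x *: f <->
    forall u, (valency u)%:R * (1 - x) * g u = \sum_(w | adj u w) g w.
  move=> fE.
  have mulE i : (f *m nlaplacian R G) 0 i =
      g (enum_val i) * Num.sqrt (valency (enum_val i))%:R
      - (\sum_(u | adj (enum_val i) u) g u) / Num.sqrt (valency (enum_val i))%:R.
    rewrite -sum_nlaplacian_entry // mxE (reindex _ (onW_bij _ (@enum_val_bij G))).
    by apply: eq_bigr => j _; rewrite fE mxE.
  split=> [eqf u | eqg].
  - have := congr1 (fun h : 'rV_#|G| => h 0 (enum_rank u)) eqf.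
    rewrite mulE mxE fE enum_rankK => e.
    have /(congr1 (fun z => z * Num.sqrt (valency u)%:R)) :
      (\sum_(w | adj u w) g w) / Num.sqrt (valency u)%:R =
      (1 - x) * (g u * Num.sqrt (valency u)%:R).
      by rewrite mulrBl mul1r -e; ring.
    by rewrite divfK // => ->; rewrite {1}sE; ring.
  - apply/rowP => i; rewrite mulE mxE fE -eqg {2}sE.
    by field; rewrite s0.
split.
- case/eigenvalueP => f eqf f0.
  pose g u := f 0 (enum_rank u) / Num.sqrt (valency u)%:R.
  have fE i : f 0 i = g (enum_val i) * Num.sqrt (valency (enum_val i))%:R.
    by rewrite /g enum_valK divfK.
  exists g; last by apply/(key f g fE).
  have /rV0Pn[i fi] := f0.
  by exists (enum_val i); apply: contraNneq fi; rewrite fE => ->; rewrite mul0r.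
- case=> g [u gu] eqg; apply/eigenvalueP.
  exists (\row_i (g (enum_val i) * Num.sqrt (valency (enum_val i))%:R)).
    by apply/(key _ g) => // i; rewrite mxE.
  apply/rV0Pn; exists (enum_rank u).
  by rewrite mxE enum_rankK mulf_neq0.
Qed.

(** * Squared incidence operators, for a plane or its dual *)

Section Incidence.

Variables (R : comPzRingType) (A B : finType) (r : A -> B -> bool) (k : nat).
Hypothesis r_card : forall a, #|[set b | r a b]| = k.
Hypothesis r_common : forall a c, a != c -> #|[set b | r a b && r c b]| = 1%N.

(* Entrywise form of N N^T = (k - 1) I + J. *)
Lemma sum_incidence2 (g : A -> R) a :
  \sum_(b | r a b) \sum_(c | r c b) g c = (k%:R - 1) * g a + \sum_c g c.
Proof.
rewrite (exchange_big_dep predT) //= (bigD1 a) //= [in RHS](bigD1 a) //=.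
rewrite addrA mulrBl mul1r subrK; congr (_ + _).
  under eq_bigl do rewrite andbb.
  rewrite sumr_const -(r_card a) mulr_natl; congr (_ *+ _).
  by apply: eq_card => b; rewrite inE.
apply: eq_bigr => c ca.
rewrite sumr_const (_ : #|_| = 1%N) // -(@r_common a c) 1?eq_sym //.
by apply: eq_card => b; rewrite inE.
Qed.

End Incidence.

(** * Duality: two lines meet in exactly one point *)

Section Plane.

Variables (k : nat) (P L : finType) (inc : P -> L -> bool).
Hypothesis hplane : projective_plane k inc.

Lemma plane_common_line p q : p != q -> #|[set l | inc p l && inc q l]| = 1%N.
Proof.
case/(plane_unique_line hplane) => l [[pl ql] lU].
rewrite -(cards1 l); congr #|pred_of_set _|; apply/setP => m; rewrite !inE.
by apply/andP/eqP => [/lU -> | ->].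
Qed.

Lemma plane_common_point_le1 l m :
  l != m -> (#|[set p | inc p l && inc p m]| <= 1)%N.
Proof.
move=> lm; rewrite leqNgt; apply: contra lm => /card_gt1P[p [q]].
rewrite !inE => -[/andP[pl pm] /andP[ql qm] pq].
have [n [_ nU]] := plane_unique_line hplane pq.
by rewrite -(nU l) // -(nU m).
Qed.

(* The k(k - 1) incidences of the points of l with other lines are spread
   over k(k - 1) lines, each taking at most one. *)
Lemma plane_common_point l m :
  l != m -> #|[set p | inc p l && inc p m]| = 1%N.
Proof.
pose c n := #|[set p | inc p l && inc p n]|.
have cE n : c n = (\sum_(p | inc p l) inc p n)%N.
  by rewrite /c -sum1dep_card big_mkcondr.
have cl : c l = k.
  rewrite -(plane_points_on_line hplane l) /c.
  by apply: eq_card => p; rewrite !inE andbb.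
(* Double counting of the incidences on points of [l]: k points, each on k lines. *)
have csum : (\sum_n c n = k * k)%N.
  under eq_bigr do rewrite cE.
  rewrite exchange_big /=.
  rewrite (eq_bigr (fun=> k)); last first.
    move=> p _; rewrite -(plane_lines_on_point hplane p) -sum1dep_card.
    by rewrite [RHS]big_mkcond.
  rewrite sum_nat_const; congr (_ * _)%N.
  by rewrite -(plane_points_on_line hplane l); apply: eq_card => p; rewrite !inE.
have k2 := plane_line_size_ge2 hplane.
have cardL : #|predC1 l| = (k * k - k)%N.
  have := cardC1 l; rewrite (plane_card_lines hplane) => ->.
  by rewrite addn1 /= -mulnn.
move=> lm; apply/eqP; rewrite eqn_leq plane_common_point_le1 //= lt0n.
apply/eqP => cm0.
(* Removing the term [c l] = k from the total leaves exactly k(k - 1), so a line missing [l] would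
   make the sum too small. *)
suff : (\sum_(n | n != l) c n < #|predC1 l|)%N.
  by move: csum; rewrite cardL (bigD1 l) //= cl; lia.
rewrite -sum1_card (bigD1 m) 1?eq_sym //= [ltnRHS](bigD1 m) /=; last by rewrite inE eq_sym.
rewrite {1}/c cm0 add0n add1n ltnS; apply: leq_sum => n /andP[nl _].
by rewrite plane_common_point_le1 // eq_sym.
Qed.

End Plane.

(** * Eigenvalue equations of the design graph and their solutions *)

Section DesignGraph.

Variables (R : rcfType) (P L : finType) (inc : P -> L -> bool) (lam : nat).
Local Notation G := (design_graph inc lam).

Lemma sum_adj_point (g : G -> R) p :
  \sum_(w | @adj G (inl p) w) g w =
  \sum_q g (inl q) - g (inl p) + \sum_(l | inc p l) \sum_i g (inr (l, i)).
Proof.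
rewrite big_sumType /=; congr (_ + _).
  rewrite [in RHS](bigD1 p) //= addrAC subrr add0r.
  by apply: eq_bigl => q; rewrite eq_sym.
rewrite pair_big_dep /=; apply: eq_big => [[l i]|[l i] _] //=.
by rewrite /block_inc /= andbT.
Qed.

Lemma sum_adj_block (g : G -> R) l i :
  \sum_(w | @adj G (inr (l, i)) w) g w =
  \sum_(p | inc p l) g (inl p) + \sum_j g (inr (l, j)) - g (inr (l, i)).
Proof.
rewrite big_sumType /= -addrA; congr (_ + _).
rewrite [in RHS](bigD1 i) //= addrAC subrr add0r.
(* Only copies of [l] contribute, so the block is determined by its copy index. *)
rewrite (reindex_onto (pair l) snd) /=.
  by apply: eq_bigl => j; rewrite xpair_eqE !eqxx andbT /= andbT eq_sym.
by case=> m j /andP[_ /eqP/= ->].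
Qed.

Variable k : nat.
Hypothesis hplane : projective_plane k inc.
Local Notation m := (k%:R + lam%:R - 1 : R).

(** This lets the adjacency sums compute degrees, and it makes the constant function 1 an
    eigenvector for 0. *)
Lemma valency_sum (u : G) : (valency u)%:R = \sum_(w | adj u w) 1 :> R.
Proof.
by rewrite sumr_const /valency; congr (_ *+ _); apply: eq_card => w; rewrite inE.
Qed.

Lemma valency_block l i : (valency (inr (l, i) : G))%:R = m.
Proof.
rewrite valency_sum sum_adj_block !sumr_const card_ord; congr (_ *+ _ + _ - _).
by rewrite -(plane_points_on_line hplane l); apply: eq_card => p; rewrite inE.
Qed.

Lemma plane_card_pointsR : #|P|%:R = k%:R ^+ 2 - k%:R + 1 :> R.
Proof.
rewrite (plane_card_points hplane) natrD natrB ?natrX //.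
by rewrite -mulnn leq_pmull // (leq_trans _ (plane_line_size_ge2 hplane)).
Qed.

(** There are v - 1 = k(k - 1) point neighbours and k lam block neighbours, so the degree is a
    multiple of the block degree m. *)
Lemma valency_point p : (valency (inl p : G))%:R = k%:R * m.
Proof.
rewrite valency_sum sum_adj_point; under [X in _ + X]eq_bigr do rewrite sumr_const card_ord.
rewrite !sumr_const plane_card_pointsR (_ : #|[pred l | inc p l]| = k).
  by rewrite -mulr_natl; ring.
by rewrite -(plane_lines_on_point hplane p); apply: eq_card => l; rewrite inE.
Qed.

Hypothesis hlam : (2 <= lam)%N.

Lemma LeigenvalueE (x : R) :
  Leigenvalue G x <->
  exists2 g : G -> R, (exists u, g u != 0) &
    (forall p, k%:R * (m * (1 - x)) * g (inl p) =
       \sum_q g (inl q) - g (inl p) + \sum_(l | inc p l) \sum_i g (inr (l, i))) /\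
    (forall l i, m * (1 - x) * g (inr (l, i)) =
       \sum_(p | inc p l) g (inl p) + \sum_j g (inr (l, j)) - g (inr (l, i))).
Proof.
have k2 : 2%:R <= k%:R :> R by rewrite ler_nat (plane_line_size_ge2 hplane).
have l2 : 2%:R <= lam%:R :> R by rewrite ler_nat.
have m0 : m != 0 by apply: lt0r_neq0; lra.
have k0 : k%:R != 0 :> R by apply: lt0r_neq0; lra.
have val0 (u : G) : valency u != 0%N.
  rewrite -(pnatr_eq0 R); case: u => [p|[l i]].
    by rewrite valency_point mulf_neq0.
  by rewrite valency_block.
split=> [/(LeigenvalueP val0)|] [g g0 gE].
- exists g => //; split=> [p|l i].
    by rewrite mulrA -sum_adj_point -gE valency_point.
  by rewrite -sum_adj_block -gE valency_block.
- apply/(LeigenvalueP val0); exists g => //.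
  case: gE => gp gb [p|[l i]].
    by rewrite sum_adj_point -gp valency_point mulrA.
  by rewrite sum_adj_block -gb valency_block.
Qed.

Lemma Leigenvalue0 : Leigenvalue G (0 : R).
Proof.
have P0 : (0 < #|P|)%N by rewrite (plane_card_points hplane) addn1.
have [p0 _] := card_gt0P P0.
apply/LeigenvalueE; exists (fun=> 1); first by exists (inl p0); rewrite oner_neq0.
split=> [p|l i]; rewrite subr0 !mulr1.
  by rewrite -(valency_point p) valency_sum (sum_adj_point (fun=> 1)).
by rewrite -(valency_block l i) valency_sum (sum_adj_block (fun=> 1)).
Qed.

(* Eigenvectors vanish on the points and sum to 0 over the copies of a line. *)
Lemma Leigenvalue_block : Leigenvalue G (1 + 1 / m).
Proof.
have k2 := plane_line_size_ge2 hplane.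
have kR : 2%:R <= k%:R :> R by rewrite ler_nat.
have l2 : 2%:R <= lam%:R :> R by rewrite ler_nat.
have m0 : m != 0 by apply: lt0r_neq0; lra.
have L0 : (0 < #|L|)%N by rewrite (plane_card_lines hplane) addn1.
have [l0 _] := card_gt0P L0.
have lam0 : (0 < lam)%N := ltnW hlam.
(* Read as 1 < lam, [hlam] provides a second copy of [l0]. *)
pose i0 := Ordinal lam0; pose i1 := Ordinal hlam.
pose h (b : block L lam) : R := (b == (l0, i0))%:R - (b == (l0, i1))%:R.
have hsum l : \sum_i h (l, i) = 0.
  rewrite sumrB; apply/eqP; rewrite subr_eq0; apply/eqP.
  have one (i : 'I_lam) : \sum_j ((l, j) == (l0, i))%:R = (l == l0)%:R :> R.
    rewrite (bigD1 i) //= xpair_eqE eqxx andbT big1 ?addr0 // => j ji.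
    by rewrite xpair_eqE (negPf ji) andbF.
  by rewrite !one.
apply/LeigenvalueE.
exists (fun u : G => match u with inl _ => 0 | inr b => h b end).
  by exists (inr (l0, i0)); rewrite /h eqxx xpair_eqE eqxx subr0 oner_neq0.
split=> [p|l i] /=.
  by rewrite mulr0 big1_eq subrr add0r big1.
by rewrite hsum big1_eq; field.
Qed.

(* Eigenvectors sum to 0 over the points and take the value
   k / (k - 1) * \sum_(p on l) g p on every copy of l. *)
Lemma Leigenvalue_point : Leigenvalue G (#|P|%:R / (k%:R * m)).
Proof.
have k2 := plane_line_size_ge2 hplane.
have kR : 2%:R <= k%:R :> R by rewrite ler_nat.
have l2 : 2%:R <= lam%:R :> R by rewrite ler_nat.
have m0 : m != 0 by apply: lt0r_neq0; lra.
have k0 : k%:R != 0 :> R by apply: lt0r_neq0; lra.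
have k1 : k%:R - 1 != 0 :> R by apply: lt0r_neq0; lra.
have P1 : (1 < #|P|)%N.
  by rewrite (plane_card_points hplane) -mulnn; nia.
have [p0 [p1 [_ _ p01]]] := card_gt1P P1.
pose g (p : P) : R := (p == p0)%:R - (p == p1)%:R.
have gsum : \sum_p g p = 0.
  have one (q : P) : \sum_p (p == q)%:R = 1 :> R.
    by rewrite (bigD1 q) //= eqxx big1 ?addr0 // => p /negPf->.
  by rewrite sumrB !one subrr.
apply/LeigenvalueE.
(* Here t = lam - 1 / k, so the block equation (t + 1 - lam) h l = \sum_(p on l) g p has coefficient
   (k - 1) / k, whose inverse appears below. *)
exists (fun u : G => match u with
  | inl p => g p
  | inr b => k%:R / (k%:R - 1) * \sum_(p | inc p b.1) g p end).
  by exists (inl p0); rewrite /g eqxx (negPf p01) subr0 oner_neq0.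
rewrite plane_card_pointsR; split=> [p|l i] /=.
  under [X in _ = _ + X]eq_bigr do rewrite sumr_const card_ord -[_ *+ lam]mulr_natl.
  rewrite -!mulr_sumr.
  rewrite (sum_incidence2 (plane_lines_on_point hplane) (plane_common_line hplane)).
  by rewrite gsum; field; rewrite k0 m0 k1.
rewrite sumr_const card_ord -[_ *+ lam]mulr_natl.
by field; rewrite k0 m0 k1.
Qed.

Lemma Leigenvalue_cases (x : R) : Leigenvalue G x ->
  [\/ x = 0, x = #|P|%:R / (k%:R * m) | x = 1 + 1 / m].
Proof.
have kR : 2%:R <= k%:R :> R by rewrite ler_nat (plane_line_size_ge2 hplane).
have l2 : 2%:R <= lam%:R :> R by rewrite ler_nat.
have m0 : m != 0 by apply: lt0r_neq0; lra.
have k0 : k%:R != 0 :> R by apply: lt0r_neq0; lra.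
have k1 : k%:R - 1 != 0 :> R by apply: lt0r_neq0; lra.
have lam0 : lam%:R != 0 :> R by apply: lt0r_neq0; lra.
pose i0 : 'I_lam := Ordinal (ltnW hlam).
case/LeigenvalueE => g [u gu] [].
set t := m * (1 - x) => gp gb.
have xt : x = 1 - t / m by rewrite /t; field.
have [t1|t1] := eqVneq (t + 1) 0.
  constructor 3; rewrite xt; have -> : t = -1 by apply/eqP; rewrite -addr_eq0 t1.
  by field.
pose h l := g (inr (l, i0)).
(* By the block equation, (t + 1) g (l, i) does not depend on i. *)
have gh l i : g (inr (l, i)) = h l.
  apply: (mulfI t1); rewrite /h !mulrDl !mul1r !gb; ring.
have hE l : (t + 1 - lam%:R) * h l = \sum_(p | inc p l) g (inl p).
  have := gb l i0; rewrite -/(h l) (eq_bigr (fun=> h l) (fun i _ => gh l i)).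
  rewrite sumr_const card_ord -[_ *+ lam]mulr_natl => e.
  by rewrite !mulrDl e; ring.
have gE p : (k%:R * t + 1) * g (inl p) =
    \sum_q g (inl q) + lam%:R * \sum_(l | inc p l) h l.
  rewrite mulrDl gp mul1r mulr_sumr -addrA addrAC -addrA addrK.
  congr (_ + _); apply: eq_bigr => l _; under eq_bigr do rewrite gh.
  by rewrite sumr_const card_ord mulr_natl.
set S := \sum_q g (inl q) in gE.
have gS p : (k%:R * t + 1 - k%:R * lam%:R) * g (inl p) = S.
  have NNT : (t + 1 - lam%:R) * \sum_(l | inc p l) h l = (k%:R - 1) * g (inl p) + S.
    rewrite -(sum_incidence2 (plane_lines_on_point hplane) (plane_common_line hplane)).
    by rewrite mulr_sumr; apply: eq_bigr => l _; rewrite hE.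
  (* Multiplying [gE] by t + 1 - lam avoids dividing by it. After substituting [NNT], the
     coefficient of g p is (t + 1 - lam)(k t + 1) - lam (k - 1) = (t + 1)(k t + 1 - k lam) and that
     of S is t + 1, so t + 1 cancels. *)
  apply: (mulfI t1); apply/eqP; rewrite -subr_eq0; apply/eqP.
  rewrite (_ : _ - _ = (t + 1 - lam%:R) * ((k%:R * t + 1) * g (inl p))
    - ((t + 1 - lam%:R) * S + lam%:R * ((k%:R - 1) * g (inl p) + S))); last by ring.
  by rewrite -NNT gE; ring.
(* Sum [gS] over all points and use v - 1 + k lam = k m. *)
have : (k%:R * t - k%:R * m) * S = 0.
  have : \sum_p (k%:R * t + 1 - k%:R * lam%:R) * g (inl p) = #|P|%:R * S.
    by under eq_bigr do rewrite gS; rewrite sumr_const mulr_natl.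
  rewrite -mulr_sumr -/S plane_card_pointsR => /eqP; rewrite -subr_eq0 => /eqP e.
  by rewrite -e; ring.
move/eqP; rewrite mulf_eq0 -mulrBr mulf_eq0 (negPf k0) /= => /orP[|/eqP S0].
  by rewrite subr_eq0 => /eqP tm; constructor 1; rewrite xt tm; field.
have [tl|tl] := eqVneq (k%:R * t + 1 - k%:R * lam%:R) 0.
  constructor 2; rewrite xt plane_card_pointsR.
  have -> : t = lam%:R - k%:R^-1.
    by apply: (mulfI k0); apply/eqP; rewrite -subr_eq0 -tl; apply/eqP; field.
  by field; rewrite k0 m0.
have g0 p : g (inl p) = 0 by apply: (mulfI tl); rewrite gS S0 mulr0.
have Nh p : \sum_(l | inc p l) h l = 0.
  by apply: (mulfI lam0); have := gE p; rewrite S0 g0 mulr0 add0r => <-; rewrite mulr0.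
(* N^T N = (k - 1) I + J by duality, and N h = 0 gives both N^T N h = 0 and
   J h = 0 (the latter by summing N h over all points). *)
have hsum : \sum_l h l = 0.
  apply: (mulfI k0); rewrite mulr0.
  have e : \sum_p \sum_(l | inc p l) h l = 0 by rewrite big1.
  rewrite -[RHS]e (exchange_big_dep predT) //= mulr_sumr.
  apply: eq_bigr => l _; rewrite sumr_const mulr_natl; congr (_ *+ _).
  by rewrite -(plane_points_on_line hplane l); apply: eq_card => p; rewrite inE.
have h0 l : h l = 0.
  apply: (mulfI k1); rewrite mulr0 -[LHS]addr0 -hsum.
  rewrite -(@sum_incidence2 _ _ _ (fun l p => inc p l) k (plane_points_on_line hplane)
    (plane_common_point hplane) h).
  by rewrite big1.
by case: u gu => [p|[l i]]; rewrite ?g0 ?gh ?h0 eqxx.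
Qed.

End DesignGraph.

Theorem mainTheorem6 (R : rcfType) (k lam v : nat)
  (P L : finType) (inc : P -> L -> bool)
  (hlam : (2 <= lam)%N)
  (hplane : projective_plane k inc)
  (hv : v = (k ^ 2 - k + 1)%N) :
  let theta1 : R := v%:R / (k%:R ^+ 2 + k%:R * (lam%:R - 1)) in
  let theta2 : R := 1 + 1 / (k%:R + lam%:R - 1) in
  uniq [:: 0; theta1; theta2] /\
  (forall x : R, Leigenvalue (design_graph inc lam) x <->
     x \in [:: 0; theta1; theta2]).
Proof.
have kR : 2%:R <= k%:R :> R by rewrite ler_nat (plane_line_size_ge2 hplane).
have l2 : 2%:R <= lam%:R :> R by rewrite ler_nat.
rewrite /= (_ : v = #|P|); last by rewrite (plane_card_points hplane).
have -> : k%:R ^+ 2 + k%:R * (lam%:R - 1) = k%:R * (k%:R + lam%:R - 1) :> R by ring.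
split; last first.
  move=> x; rewrite !inE; split=> [/(Leigenvalue_cases hplane hlam)|].
    by case=> ->; rewrite eqxx ?orbT.
  case/or3P => /eqP->.
  - exact: Leigenvalue0 hplane hlam.
  - exact: Leigenvalue_point hplane hlam.
  - exact: Leigenvalue_block hplane hlam.
have m0 : 0 < k%:R + lam%:R - 1 :> R by lra.
have km0 : 0 < k%:R * (k%:R + lam%:R - 1) :> R by rewrite mulr_gt0 //; lra.
have v0 : 0 < #|P|%:R :> R by rewrite (plane_card_pointsR R hplane); nra.
have th1 : 0 < #|P|%:R / (k%:R * (k%:R + lam%:R - 1)) :> R by rewrite divr_gt0.
(* The value 1 separates the two: v < k m amounts to 1 < k lam. *)
have th2 : #|P|%:R / (k%:R * (k%:R + lam%:R - 1)) < 1 + 1 / (k%:R + lam%:R - 1) :> R.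
  apply: (@lt_trans _ _ 1); last by rewrite ltrDl divr_gt0.
  by rewrite ltr_pdivrMr // mul1r (plane_card_pointsR R hplane); nra.
rewrite !inE !negb_or /= andbT -andbA; apply/and3P; split; try by rewrite lt_eqF.
by rewrite lt_eqF // (lt_trans th1 th2).
Qed.
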